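(* Let $(G,D(\Delta))$ be a Garside system with $D(\Delta)$ finite, so that $G$ is a Garside group associated with the Garside monoid $G^+$. Then: (d) every Garside subgroup of $G$ is a Garside group associated with some Garside submonoid of $G^+$ (i.e. it is the group of fractions of a Garside submonoid of $G^+$ which is a Garside monoid); (e) if $H$ is a Garside subgroup of $G$ and $x$ belongs to $H$, then the fractional decomposition of $x$ in $H$ coincides with its fractional decomposition in $G$; (f) the intersection of two Garside subgroups of $G$ is a Garside subgroup of $G$.
   Context: Divisibility. In a monoid $M$, $g$ left-divides $h$ (written $g\prec h$) if $h=gk$ for some $k\in M$, and $g$ right-divides $h$ (written $h\succ g$) if $h=kg$ for some $k\in M$. $L(h)$ and $R(h)$ denote the sets of left-divisors and right-divisors of $h$. $M$ is cancellative if $ghk=gh'k$ implies $h=h'$; $M$ is Noetherian if for every $g\in M$ the set $\{k\in\mathbb N\mid g=g_1\cdots g_k,\ g_i\in M,\ g_i\neq 1\}$ is finite. $\Delta\in M$ is balanced if $L(\Delta)=R(\Delta)$; this common set is then denoted $D(\Delta)$. Garside systems. A pair $(G^+,X)$, with $G^+$ a monoid and $X\subset G^+$, is a positive Garside system if: $G^+$ is Noetherian and cancellative; $G^+$ is a lattice for $\prec$ and a lattice for $\succ$; $X$ generates $G^+$ and $X=D(\Delta)$ for some balanced $\Delta\in G^+$. Then $\Delta$ is the Garside element and $G^+$ is a quasi-Garside monoid, called a Garside monoid if $D(\Delta)$ is finite. For a group $G$ and $X\subset G$, let $G^+$ be the submonoid of $G$ generated by $X$; $(G,X)$ is a Garside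 system if $(G^+,X)$ is a positive Garside system and $G$ is the group of fractions of $G^+$. $G$ is then a quasi-Garside group, and a Garside group if $G^+$ is a Garside monoid. The g.c.d. and l.c.m. of $g,h$ are denoted $g\land_L h$, $g\lor_L h$ for $\prec$ and $g\land_R h$, $g\lor_R h$ for $\succ$. Put $\alpha_L(w)=w\land_L\Delta$ and $\alpha_R(w)=w\land_R\Delta$ for $w\in G^+$. Garside subgroups. A submonoid $H^+$ of $G^+$ is a Garside submonoid if (1) $H^+$ is a sublattice of $G^+$ for left-divisibility and for right-divisibility (closed under $\land_L,\lor_L$ and under $\land_R,\lor_R$, computed in $G^+$), and (2) $\alpha_L(H^+)\subset H^+$ and $\alpha_R(H^+)\subset H^+$. A subgroup $H$ of $G$ is a Garside subgroup if $H^+=H\cap G^+$ is a Garside submonoid of $G^+$ and generates $H$. Fractional decomposition. For $g\in G$ there is a unique pair $(a,b)$ of elements of $G^+$ with $g=a^{-1}b$ and $a\land_L b=1$; this is the fractional decomposition (left normal form) of $g$ in $G$. The fractional decomposition in a Garside subgroup $H$ is defined in the same way with $H^+=H\cap G^+$ in place of $G^+$. *)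

(* Defs.v *)
From HB Require Import structures.
From mathcomp Require Import all_boot.
From mathcomp Require Import boolp classical_sets functions cardinality.

Set Implicit Arguments.
Unset Strict Implicit.
Unset Printing Implicit Defensive.

Local Open Scope group_scope.
Local Open Scope classical_set_scope.

(* Monoids are handled as submonoids M : set T of an ambient monoid T.        *)
(* Every notion below is intrinsic to M: quotients, factors, bounds and so on *)
(* are required to lie in M.  An abstract monoid is the case M = setT.        *)

Section Monoids.
Variable T : monoidType.
Implicit Types (M N X : set T) (g h : T).

Definition submonoid M : Prop := monoid_closed (mem M).

Definition monoid_gen X : set T := smallest submonoid X.

Definition ldiv M g h : Prop := exists2 k, M k & h = g * k.

Definition rdiv M g h : Prop := exists2 k, M k & h = k * g.

Definition ldivisors M h : set T := [set g | M g /\ ldiv M g h].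

Definition rdivisors M h : set T := [set g | M g /\ rdiv M g h].

Definition cancellative M : Prop :=
  forall g h h' k, M g -> M h -> M h' -> M k ->
    g * h * k = g * h' * k -> h = h'.

Definition noetherian M : Prop :=
  forall g, M g ->
    finite_set [set k : nat | exists s : seq T,
      [/\ size s = k, forall x, x \in s -> M x /\ x <> 1
        & g = \prod_(x <- s) x]].

Definition balanced M h : Prop := ldivisors M h = rdivisors M h.

Definition is_glb M (le : T -> T -> Prop) x y d : Prop :=
  [/\ M d, le d x, le d y &
      forall e, M e -> le e x -> le e y -> le e d].

Definition is_lub M (le : T -> T -> Prop) x y m : Prop :=
  [/\ M m, le x m, le y m &
      forall e, M e -> le x e -> le y e -> le m e].

Definition gcdL M := is_glb M (ldiv M).
Definition lcmL M := is_lub M (ldiv M).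
Definition gcdR M := is_glb M (rdiv M).
Definition lcmR M := is_lub M (rdiv M).

(* Reflexivity and transitivity are automatic for divisibility in a monoid;   *)
(* antisymmetry is not.                                                       *)
Definition lattice_for M (le : T -> T -> Prop) : Prop :=
  [/\ forall x y, M x -> M y -> le x y -> le y x -> x = y,
      forall x y, M x -> M y -> exists d, is_glb M le x y d
    & forall x y, M x -> M y -> exists m, is_lub M le x y m].

Definition garside_element M X Delta : Prop :=
  [/\ M Delta, balanced M Delta & X = ldivisors M Delta].

Definition positive_garside_system M X : Prop :=
  [/\ submonoid M,
      noetherian M /\ cancellative M,
      lattice_for M (ldiv M) /\ lattice_for M (rdiv M),
      monoid_gen X = M
    & exists Delta, garside_element M X Delta].

Definition garside_monoid M : Prop :=
  exists2 X, positive_garside_system M X & finite_set X.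

(* The lattice operations are those of M, not of N.  The last two conditions  *)
(* say that N is stable under w |-> gcdL w Delta and w |-> gcdR w Delta.      *)
Definition garside_submonoid M Delta N : Prop :=
  [/\ submonoid N /\ N `<=` M,
      forall x y z, N x -> N y -> gcdL M x y z \/ lcmL M x y z -> N z,
      forall x y z, N x -> N y -> gcdR M x y z \/ lcmR M x y z -> N z,
      forall w z, N w -> gcdL M w Delta z -> N z
    & forall w z, N w -> gcdR M w Delta z -> N z].

End Monoids.

Section Groups.
Variable G : groupType.
Implicit Types (H M X : set G) (x : G).

Definition subgroup H : Prop := group_closed (mem H).

Definition group_gen X : set G := smallest subgroup X.

(* Since H is a subgroup and M a submonoid of the ambient group, M embeds in  *)
(* H; one then asks that every element of H be a fraction of elements of M.   *)
Definition group_of_fractions M H : Prop :=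
  [/\ subgroup H, submonoid M & H = [set a^-1 * b | a in M & b in M]].

Definition garside_system X : Prop :=
  positive_garside_system (monoid_gen X) X /\
  group_of_fractions (monoid_gen X) [set: G].

Definition garside_subgroup M Delta H : Prop :=
  [/\ subgroup H,
      garside_submonoid M Delta (H `&` M)
    & group_gen (H `&` M) = H].

Definition fractional_decomposition M x (ab : G * G) : Prop :=
  [/\ M ab.1, M ab.2, x = ab.1^-1 * ab.2 & gcdL M ab.1 ab.2 1].

End Groups.

(* Main.v *)
Require Import Defs.
From HB Require Import structures.
From mathcomp Require Import all_boot.
From mathcomp Require Import boolp classical_sets functions cardinality.

Set Implicit Arguments.
Unset Strict Implicit.
Unset Printing Implicit Defensive.

Local Open Scope group_scope.
Local Open Scope classical_set_scope.

(** Let [M] be the Garside monoid and [N = H `&` M].  Since [H] is a subgroup,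
    divisibility in [N] is the restriction of divisibility in [M] ([ldivI],
    [rdivI]); as [N] is stable under the gcds and lcms of [M], these are also
    its own, and [N] is a lattice on both sides.

    (d) The existence of common left multiples in [N] shows that left fractions
    of elements of [N] form a group, hence all of [H], which [N] generates
    ([group_of_fractions_gen]).  The set [H `&` X] of simple elements lying in
    [H] is finite and stable under lcms, so it has a greatest element [delta]
    on the left and one on the right; noetherianity forces the two to coincide,
    and [delta], a divisor of [Delta], is the Garside element of [N]
    ([garside_subgroup_element]).  Finally [H `&` X] generates [N]: every
    nontrivial [g] in [N] is left-divisible by its left gcd with [Delta], a
    nontrivial element of [H `&` X], and noetherian induction applies to the
    quotient ([garside_subgroup_simple_gen]).

    (e) An element of [H] is a fraction of elements of [N]; cancelling their
    gcd, which is the same in [N] and in [M], yields one pair that is reduced in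
    both ([garside_subgroup_decomposition]).  Reduced fractions are unique in
    any lattice submonoid ([fractional_decomposition_unique]).

    (f) An intersection inherits every closure property at once.  That
    [H `&` K `&` M] generates [H `&` K] follows from (e): the reduced fraction
    of an element of [H `&` K] has its terms in [H] and in [K]
    ([garside_subgroupI]). *)

(** * Divisibility in submonoids *)

Section Monoids.
Variable T : monoidType.
Implicit Types (M X F : set T) (g h k x y : T).

Lemma submonoidP M :
  submonoid M <-> M 1 /\ forall x y, M x -> M y -> M (x * y).
Proof.
split=> -[M1 MM]; split.
- by move: M1; rewrite inE.
- by move=> x y Mx My; have := MM x y; rewrite !inE; apply.
- by rewrite inE.
- by move=> x y; rewrite !inE; apply: MM.
Qed.

Lemma submonoid_gen X : submonoid (monoid_gen X).
Proof.
apply/submonoidP; split=> [M [/submonoidP[M1 _] _] //|x y gx gy M MX].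
by have [/submonoidP[_ MM] _] := MX; apply: MM; [apply: gx|apply: gy].
Qed.

Lemma ldiv_refl M g : submonoid M -> ldiv M g g.
Proof. by case/submonoidP=> M1 _; exists 1; rewrite ?mulg1. Qed.

Lemma ldiv_trans M h g k :
  submonoid M -> ldiv M g h -> ldiv M h k -> ldiv M g k.
Proof.
case/submonoidP=> _ MM [a Ma ->] [b Mb ->].
by exists (a * b); [apply: MM|rewrite mulgA].
Qed.

Lemma rdiv_trans M h g k :
  submonoid M -> rdiv M g h -> rdiv M h k -> rdiv M g k.
Proof.
case/submonoidP=> _ MM [a Ma ->] [b Mb ->].
by exists (b * a); [apply: MM|rewrite mulgA].
Qed.

Lemma ldivs1_eq1 M g :
  submonoid M -> lattice_for M (ldiv M) -> M g -> ldiv M g 1 -> g = 1.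
Proof.
case/submonoidP=> M1 _ [anti _ _] Mg g1; apply: anti => //.
by exists g; rewrite ?mul1g.
Qed.

(** The largest length of a factorization into nontrivial elements drops when
    a nontrivial left factor is split off, so that the proper right factors of
    an element support well-founded induction. *)
Lemma noetherian_ind M (Q : T -> Prop) :
    noetherian M ->
    (forall g, M g ->
      (forall x h, M x -> x <> 1 -> M h -> g = x * h -> Q h) -> Q g) ->
  forall g, M g -> Q g.
Proof.
move=> noeM step g Mg.
pose factors (s : seq T) h :=
  (forall x, x \in s -> M x /\ x <> 1) /\ h = \prod_(x <- s) x.
have factors_cons x h s :
    M x -> x <> 1 -> factors s h -> factors (x :: s) (x * h).
  move=> Mx x1 [sM ->]; split=> [y|]; last by rewrite big_cons.
  by rewrite inE => /predU1P[->|/sM].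
have [n bound] : exists n, forall s, factors s g -> size s <= n.
  have /finite_seqP[ns nsE] := noeM g Mg.
  exists (\max_(i <- ns) i) => s [sM gs].
  have : [set` ns] (size s) by rewrite -nsE /=; exists s.
  by move=> /= s_ns; apply: leq_bigmax_seq.
elim: n => [|n IHn] in g Mg bound *; apply: step => // x h Mx x1 Mh gE.
  have [s hs] : exists s, factors s h.
    have [->|/eqP h1] := eqVneq h 1.
      by exists [::]; split; rewrite ?big_nil.
    by exists [:: h]; split=> [y|]; rewrite ?big_seq1 // inE => /eqP ->.
  by have := bound (x :: s); rewrite gE => /(_ (factors_cons _ _ _ Mx x1 hs)).
apply: IHn => // s hs.
by have := bound (x :: s); rewrite gE => /(_ (factors_cons _ _ _ Mx x1 hs)).
Qed.

(** If [g = k * g * l], then [g * l] is a right factor of [g] for which the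
    same equation holds, so a nontrivial [k] would allow an infinite descent. *)
Lemma noetherian_absorb M k l g : submonoid M -> noetherian M ->
  M k -> M l -> M g -> g = k * (g * l) -> k = 1.
Proof.
case/submonoidP=> _ MM noeM Mk Ml; move: g.
apply: (noetherian_ind noeM) => g Mg IH gE.
have [//|/eqP k1] := eqVneq k 1.
apply: (IH k (g * l)) => //; first exact: MM.
by rewrite {1}gE !mulgA.
Qed.

Lemma finite_directed_max (le : T -> T -> Prop) F e :
    finite_set F -> F e -> (forall x y z, le x y -> le y z -> le x z) ->
    (forall x y, F x -> F y -> exists z, [/\ F z, le x z & le y z]) ->
  exists2 m, F m & forall x, F x -> le x m.
Proof.
move=> /finite_seqP[s FE] Fe le_trans dirF.
suff [m Fm max_m] : exists2 m, F m & forall x, F x -> x \in s -> le x m.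
  by exists m => // x Fx; apply: max_m => //; move: Fx; rewrite FE.
elim: s {FE} => [|a s [m Fm max_m]]; first by exists e.
have [Fa|nFa] := pselect (F a); last first.
  exists m => // x Fx; rewrite inE => /predU1P[xa|]; last exact: max_m.
  by case: nFa; rewrite -xa.
have [z [Fz az mz]] := dirF _ _ Fa Fm; exists z => // x Fx.
by rewrite inE => /predU1P[->//|/(max_m _ Fx) xm]; apply: le_trans mz.
Qed.

Lemma monoid_gen_ldiv X g : monoid_gen X g -> g <> 1 ->
  exists2 x, X x /\ x <> 1 & ldiv (monoid_gen X) x g.
Proof.
have genM := submonoid_gen X; have [gen1 genMM] := (submonoidP _).1 genM.
pose Q := [set h | monoid_gen X h /\ (h <> 1 ->
  exists2 x, X x /\ x <> 1 & ldiv (monoid_gen X) x h)].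
suff sQ : monoid_gen X `<=` Q by move=> /sQ[].
apply: smallest_sub => [|x Xx].
  apply/submonoidP; split=> [|h k [gh hQ] [gk kQ]]; first by split.
  split=> [|hk1]; first exact: genMM.
  have [h1|/eqP h1] := eqVneq h 1.
    by move: hk1; rewrite h1 mul1g.
  have [x Xx xh] := hQ h1; exists x => //.
  by apply: ldiv_trans xh _ => //; exists k.
split; first exact: sub_gen_smallest.
by move=> x1; exists x => //; apply: ldiv_refl.
Qed.

End Monoids.

(** * Fractions in a lattice submonoid of a group *)

Section Groups.
Variable G : groupType.
Implicit Types (H K M X : set G) (a b g h x y : G).

Lemma subgroupP H :
  subgroup H <-> H 1 /\ forall x y, H x -> H y -> H (x * y^-1).
Proof.
split=> -[H1 HD]; split.
- by move: H1; rewrite inE.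
- by move=> x y Hx Hy; have := HD x y; rewrite !inE; apply.
- by rewrite inE.
- by move=> x y; rewrite !inE; apply: HD.
Qed.

Lemma subgroupV H x : subgroup H -> H x -> H x^-1.
Proof. by case/subgroupP=> H1 HD Hx; rewrite -[x^-1]mul1g; apply: HD. Qed.

Lemma subgroupM H x y : subgroup H -> H x -> H y -> H (x * y).
Proof.
move=> sgH Hx /(subgroupV sgH) Hy; have [_ HD] := (subgroupP H).1 sgH.
by rewrite -[y]invgK; apply: HD.
Qed.

Lemma subgroupI H K : subgroup H -> subgroup K -> subgroup (H `&` K).
Proof.
move=> /subgroupP[H1 HD] /subgroupP[K1 KD]; apply/subgroupP; split=> //.
by move=> x y [Hx Kx] [Hy Ky]; split; [apply: HD|apply: KD].
Qed.

Lemma subgroup_gen X : subgroup (group_gen X).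
Proof.
apply/subgroupP; split=> [H [/subgroupP[H1 _] _] //|x y gx gy H HX].
by have [/subgroupP[_ HD] _] := HX; apply: HD; [apply: gx|apply: gy].
Qed.

Lemma mem_group_gen X x : X x -> group_gen X x.
Proof. by move=> Xx H [_]; apply. Qed.

(** The quotient of two elements of a subgroup stays in it, so divisibility
    inside [H `&` M] is the restriction of divisibility in [M]. *)
Lemma ldivI H M x y : subgroup H -> H x -> H y ->
  ldiv (H `&` M) x y <-> ldiv M x y.
Proof.
move=> sgH Hx Hy; split=> [[k [_ Mk] ->]|[k Mk yE]]; first by exists k.
exists k => //; split=> //.
by rewrite -[k](mulKg x) -yE; exact: subgroupM (subgroupV sgH Hx) Hy.
Qed.

Lemma rdivI H M x y : subgroup H -> H x -> H y ->
  rdiv (H `&` M) x y <-> rdiv M x y.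
Proof.
move=> sgH Hx Hy; split=> [[k [_ Mk] ->]|[k Mk yE]]; first by exists k.
exists k => //; split=> //.
by rewrite -[k](mulgK x) -yE; exact: subgroupM (subgroupV sgH Hx).
Qed.

Lemma lattice_for_sub M N (leM leN : G -> G -> Prop) :
    N `<=` M -> (forall x y, N x -> N y -> leN x y <-> leM x y) ->
    (forall x y z, N x -> N y ->
      is_glb M leM x y z \/ is_lub M leM x y z -> N z) ->
  lattice_for M leM -> lattice_for N leN.
Proof.
move=> NM leE closed [anti glb lub]; split=> [x y Nx Ny|x y Nx Ny|x y Nx Ny].
- move=> /(leE _ _ Nx Ny) xy /(leE _ _ Ny Nx) yx.
  by apply: anti => //; apply: NM.
- have [d dP] := glb x y (NM _ Nx) (NM _ Ny).
  have Nd : N d by apply: (closed x y d) => //; left.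
  have [_ dx dy dmax] := dP; exists d; split=> //; try (by apply/leE).
  move=> e Ne /(leE _ _ Ne Nx) ex /(leE _ _ Ne Ny) ey.
  by apply/leE => //; apply: dmax => //; apply: NM.
- have [d dP] := lub x y (NM _ Nx) (NM _ Ny).
  have Nd : N d by apply: (closed x y d) => //; right.
  have [_ dx dy dmax] := dP; exists d; split=> //; try (by apply/leE).
  move=> e Ne /(leE _ _ Nx Ne) ex /(leE _ _ Ny Ne) ey.
  by apply/leE => //; apply: dmax => //; apply: NM.
Qed.

(** The gcd of [p * a] and [p * b] is a multiple of [p], and its cofactor is a
    common divisor of [a] and [b]. *)
Lemma gcdL_mull M p a b d : submonoid M -> lattice_for M (ldiv M) ->
  M p -> M a -> M b -> gcdL M a b 1 -> gcdL M (p * a) (p * b) d -> d = p.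
Proof.
move=> sM latM Mp Ma Mb [_ _ _ max1] [Md [u Mu paE] [v Mv pbE] maxd].
have [e Me dE] : ldiv M p d by apply: maxd => //; [exists a|exists b].
suff e1 : e = 1 by rewrite dE e1 mulg1.
apply: (ldivs1_eq1 sM latM) => //; apply: max1 => //.
  by exists u => //; apply: (mulgI p); rewrite paE dE mulgA.
by exists v => //; apply: (mulgI p); rewrite pbE dE mulgA.
Qed.

(** Write [a^-1 * b = c^-1 * d] and let [p * a = q * c] be a common left
    multiple; then also [p * b = q * d], and [p] and [q] are both the gcd of
    this pair of elements. *)
Lemma fractional_decomposition_unique M x ab cd : submonoid M ->
    lattice_for M (ldiv M) -> lattice_for M (rdiv M) ->
    fractional_decomposition M x ab -> fractional_decomposition M x cd ->
  ab = cd.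
Proof.
case: ab cd => [a b] [c d] sM latL [_ _ lcm].
case=> /= Ma Mb xE gcd_ab [/= Mc Md xE' gcd_cd].
have [anti gcd _] := latL; have [_ MM] := (submonoidP M).1 sM.
have [m [_ [p Mp mE] [q Mq mE'] _]] := lcm a c Ma Mc.
have paqc : p * a = q * c by rewrite -mE.
have pbqd : p * b = q * d.
  have -> : b = a * x by rewrite xE mulVKg.
  have -> : d = c * x by rewrite xE' mulVKg.
  by rewrite !mulgA paqc.
have [g gP] := gcd _ _ (MM _ _ Mp Ma) (MM _ _ Mp Mb).
have gp := gcdL_mull sM latL Mp Ma Mb gcd_ab gP.
rewrite paqc pbqd in gP.
have gq := gcdL_mull sM latL Mq Mc Md gcd_cd gP.
rewrite gp in gq; rewrite gq in paqc pbqd.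
by rewrite (mulgI _ _ _ paqc) (mulgI _ _ _ pbqd).
Qed.

(** Cancelling the gcd of numerator and denominator. *)
Lemma fractional_decomposition_exists M a0 b0 : submonoid M ->
    lattice_for M (ldiv M) -> M a0 -> M b0 ->
  exists ab, fractional_decomposition M (a0^-1 * b0) ab.
Proof.
move=> sM [_ gcd _] Ma Mb; have [M1 MM] := (submonoidP M).1 sM.
have [d [Md [a Ma' aE] [b Mb' bE] maxd]] := gcd _ _ Ma Mb.
exists (a, b); split=> //=.
  by rewrite aE bE invgM -mulgA mulKg.
split=> //; [by exists a; rewrite ?mul1g|by exists b; rewrite ?mul1g|].
move=> e Me [u Mu ue] [v Mv ve].
have [|||f Mf dE] := maxd (d * e).
- exact: MM.
- by exists u => //; rewrite aE ue mulgA.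
- by exists v => //; rewrite bE ve mulgA.
by exists f => //; apply: (mulgI d); rewrite mulg1 mulgA.
Qed.

(** Common left multiples turn a right fraction [b * c^-1] into a left one,
    which makes the set of left fractions stable under products. *)
Lemma group_of_fractions_gen M : submonoid M -> lattice_for M (rdiv M) ->
  group_of_fractions M (group_gen M).
Proof.
move=> sM [_ _ lcm]; have [M1 MM] := (submonoidP M).1 sM.
have sgM := subgroup_gen M.
split=> //; apply/seteqP; split; last first.
  move=> _ [a /mem_group_gen Ma [b /mem_group_gen Mb <-]].
  exact: subgroupM (subgroupV sgM Ma) Mb.
apply: smallest_sub => [|x Mx]; last first.
  by exists 1 => //; exists x => //; rewrite invg1 mul1g.
apply/subgroupP; split=> [|_ _ [a Ma [b Mb <-]] [c Mc [d Md <-]]].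
  by exists 1 => //; exists 1 => //; rewrite invg1 mul1g.
have [m [_ [p Mp mE] [q Mq mE'] _]] := lcm b d Mb Md.
exists (p * a); first exact: MM.
exists (q * c); first exact: MM.
have -> : q = p * b * d^-1 by rewrite -mE mE' mulgK.
by rewrite !invgM invgK !mulgA mulgVK.
Qed.

(** * Garside subgroups *)

Lemma garside_subgroup_lattices M Delta H :
    lattice_for M (ldiv M) -> lattice_for M (rdiv M) ->
    garside_subgroup M Delta H ->
  lattice_for (H `&` M) (ldiv (H `&` M)) /\
  lattice_for (H `&` M) (rdiv (H `&` M)).
Proof.
move=> latL latR [sgH [[sN NM] clL clR _ _] _]; split.
  by apply: lattice_for_sub clL latL => // x y [Hx _] [Hy _]; apply: ldivI.
by apply: lattice_for_sub clR latR => // x y [Hx _] [Hy _]; apply: rdivI.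
Qed.

Lemma garside_subgroup_fractions M Delta H :
    lattice_for M (ldiv M) -> lattice_for M (rdiv M) ->
    garside_subgroup M Delta H -> group_of_fractions (H `&` M) H.
Proof.
move=> latL latR gH.
have [_ latNR] := garside_subgroup_lattices latL latR gH.
have [_ [[sN _] _ _ _ _] genH] := gH.
by have := group_of_fractions_gen sN latNR; rewrite genH.
Qed.

(** A fraction of elements of [H `&` M] is reduced by the gcd taken in [M],
    which lies in [H]: this is why the two decompositions agree. *)
Lemma garside_subgroup_decomposition M Delta H x : submonoid M ->
    lattice_for M (ldiv M) -> lattice_for M (rdiv M) ->
    garside_subgroup M Delta H -> H x ->
  exists ab, fractional_decomposition (H `&` M) x ab /\
             fractional_decomposition M x ab.
Proof.
move=> sM latL latR gH Hx.
have [latNL _] := garside_subgroup_lattices latL latR gH.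
have [_ sN HE] := garside_subgroup_fractions latL latR gH.
have [sgH [_ clL _ _ _] _] := gH.
have : [set a^-1 * b | a in H `&` M & b in H `&` M] x by rewrite -HE.
case=> a0 Na0 [b0 Nb0 <-].
have [[a b] abN] := fractional_decomposition_exists sN latNL Na0 Nb0.
exists (a, b); split=> //; have [/= Na Nb xE [_ _ _ max1]] := abN.
have [M1 _] := (submonoidP M).1 sM.
case: (Na) (Nb) => [Ha Ma] [Hb Mb].
split=> //=; split=> //; [by exists a; rewrite ?mul1g| |].
  by exists b; rewrite ?mul1g.
move=> e Me ea eb; have [_ gcd _] := latL.
have [d dP] := gcd a b Ma Mb.
have [Hd Md] : (H `&` M) d by apply: (clL a b) => //; left.
have [_ da db maxd] := dP.
apply: (ldiv_trans sM (maxd e Me ea eb)).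
have H1 : H 1 by have [] := (subgroupP H).1 sgH.
by apply/(ldivI M sgH Hd H1); apply: max1 => //; apply/ldivI.
Qed.

(** Descent: split off the left gcd of [g] and [Delta], which lies in [H] and
    is nontrivial as soon as [g] is, because some nontrivial element of [X]
    divides both. *)
Lemma garside_subgroup_simple_gen X Delta H :
    positive_garside_system (monoid_gen X) X ->
    garside_element (monoid_gen X) X Delta ->
    garside_subgroup (monoid_gen X) Delta H ->
  monoid_gen (H `&` X) = H `&` monoid_gen X.
Proof.
set M := monoid_gen X.
move=> [sM [noeM _] [latL _] _ _] [MD _ XE] [sgH [[sN _] _ _ clD _] _].
apply/seteqP; split.
  by apply: smallest_sub => // x [Hx Xx]; split=> //; apply: sub_gen_smallest.
move=> g [Hg Mg]; move: g Mg Hg.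
apply: (noetherian_ind noeM) => g Mg IH Hg.
have [sL1 sLM] := (submonoidP _).1 (submonoid_gen (H `&` X)).
have [->//|/eqP g1] := eqVneq g 1.
have [_ gcd _] := latL; have [d dP] := gcd g Delta Mg MD.
have [Hd Md] : (H `&` M) d by apply: (clD g).
have [_ [h Mh gE] dD maxd] := dP.
have d1 : d <> 1.
  move=> d1; have [x [Xx x1] xg] := monoid_gen_ldiv Mg g1.
  apply: x1; have Mx : M x by apply: sub_gen_smallest.
  apply: (ldivs1_eq1 sM latL) => //; rewrite -d1; apply: maxd => //.
  by move: Xx; rewrite XE => -[].
have Hh : H h.
  by rewrite -[h](mulKg d) -gE; exact: subgroupM (subgroupV sgH Hd) Hg.
rewrite gE; apply: sLM; last exact: (IH d h).
by apply: sub_gen_smallest; split=> //; rewrite XE.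
Qed.

(** [Delta] itself need not lie in [H].  The finite set [H `&` X] has a largest
    element for left-divisibility and one for right-divisibility, since it is
    stable under both lcms; each divides the other, on opposite sides, so they
    are equal and form the Garside element of [H `&` M]. *)
Lemma garside_subgroup_element X Delta H : finite_set X ->
    positive_garside_system (monoid_gen X) X ->
    garside_element (monoid_gen X) X Delta ->
    garside_subgroup (monoid_gen X) Delta H ->
  exists delta, garside_element (H `&` monoid_gen X) (H `&` X) delta.
Proof.
set M := monoid_gen X.
move=> finX [sM [noeM _] [latL latR] _ _] [MD balD XE].
move=> [sgH [[sN _] clL clR _ _] _].
have XER : X = rdivisors M Delta by rewrite XE balD.
have [M1 _] := (submonoidP M).1 sM.
have [H1 _] := (subgroupP H).1 sgH.
have finHX : finite_set (H `&` X) by apply: sub_finite_set finX => x [].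
have HX1 : (H `&` X) 1.
  by split=> //; rewrite XE; split=> //; exists Delta; rewrite ?mul1g.
have [dl [Hdl Xdl] maxl] :
    exists2 m, (H `&` X) m & forall x, (H `&` X) x -> ldiv M x m.
  apply: (finite_directed_max finHX HX1) => [x y z|x y [Hx Xx] [Hy Xy]].
    exact: ldiv_trans.
  move: (Xx) (Xy); rewrite {1 2}XE => -[Mx xD] [My yD].
  have [_ _ lcm] := latL; have [z zP] := lcm x y Mx My.
  have [Hz Mz] : (H `&` M) z by apply: (clL x y) => //; right.
  have [_ xz yz minz] := zP; exists z; split=> //; split=> //.
  by rewrite XE; split=> //; apply: minz.
have [dr [Hdr Xdr] maxr] :
    exists2 m, (H `&` X) m & forall x, (H `&` X) x -> rdiv M x m.
  apply: (finite_directed_max finHX HX1) => [x y z|x y [Hx Xx] [Hy Xy]].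
    exact: rdiv_trans.
  move: (Xx) (Xy); rewrite {1 2}XER => -[Mx xD] [My yD].
  have [_ _ lcm] := latR; have [z zP] := lcm x y Mx My.
  have [Hz Mz] : (H `&` M) z by apply: (clR x y) => //; right.
  have [_ xz yz minz] := zP; exists z; split=> //; split=> //.
  by rewrite XER; split=> //; apply: minz.
have XM x : X x -> M x by rewrite XE => -[].
have drdl : dr = dl.
  have [k Mk drE] := maxr dl (conj Hdl Xdl).
  have [l Ml dlE] := maxl dr (conj Hdr Xdr).
  suff k1 : k = 1 by rewrite drE k1 mul1g.
  apply: (noetherian_absorb sM noeM Mk Ml (XM _ Xdl)).
  by rewrite mulgA -drE.
have ldE : ldivisors (H `&` M) dl = H `&` X.
  apply/seteqP; split=> [x [[Hx Mx] /(ldivI _ sgH Hx Hdl) xdl]|x [Hx Xx]].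
    split=> //; rewrite XE; split=> //; apply: ldiv_trans xdl _ => //.
    by move: Xdl; rewrite XE => -[].
  split; first by split=> //; apply: XM.
  by apply/ldivI => //; apply: maxl.
have rdE : rdivisors (H `&` M) dl = H `&` X.
  apply/seteqP; split=> [x [[Hx Mx] /(rdivI _ sgH Hx Hdl) xdl]|x [Hx Xx]].
    split=> //; rewrite XER; split=> //; apply: rdiv_trans xdl _ => //.
    by move: Xdl; rewrite XER => -[].
  split; first by split=> //; apply: XM.
  by apply/rdivI => //; rewrite -drdl; apply: maxr.
exists dl; split=> //; first by split=> //; apply: XM.
by rewrite /balanced ldE rdE.
Qed.

Lemma garside_subgroup_monoid X Delta H : finite_set X ->
    positive_garside_system (monoid_gen X) X ->
    garside_element (monoid_gen X) X Delta ->
    garside_subgroup (monoid_gen X) Delta H ->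
  garside_monoid (H `&` monoid_gen X).
Proof.
move=> finX sysX XD gH; exists (H `&` X); last first.
  by apply: sub_finite_set finX => x [].
have [sM [noeM _] [latL latR] _ _] := sysX.
have [sgH [[sN NM] _ _ _ _] _] := gH.
split=> //; last exact: garside_subgroup_element gH.
- split; last by move=> g h h' k _ _ _ _ /mulIg/mulgI.
  move=> g /NM Mg; apply: sub_finite_set (noeM g Mg) => k [s [sk sN' gE]].
  by exists s; split=> // x /sN'[/NM].
- exact: garside_subgroup_lattices gH.
- exact: garside_subgroup_simple_gen gH.
Qed.

Lemma garside_submonoidI M Delta N N' :
    garside_submonoid M Delta N -> garside_submonoid M Delta N' ->
  garside_submonoid M Delta (N `&` N').
Proof.
move=> [[/submonoidP[N1 NMul] NM] l1 r1 a1 b1].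
move=> [[/submonoidP[N1' NMul'] _] l2 r2 a2 b2]; split.
- split=> [|x [/NM]//]; apply/submonoidP; split=> // x y [Nx N'x] [Ny N'y].
  by split; [apply: NMul|apply: NMul'].
- by move=> x y z [? ?] [? ?] ?; split; [apply: (l1 x y)|apply: (l2 x y)].
- by move=> x y z [? ?] [? ?] ?; split; [apply: (r1 x y)|apply: (r2 x y)].
- by move=> w z [? ?] ?; split; [apply: (a1 w)|apply: (a2 w)].
- by move=> w z [? ?] ?; split; [apply: (b1 w)|apply: (b2 w)].
Qed.

(** Generation is the only point at issue: the decompositions of an element in
    [H] and in [K] are both the one in [M], whose terms therefore lie in
    [H `&` K]. *)
Lemma garside_subgroupI M Delta H K : submonoid M ->
    lattice_for M (ldiv M) -> lattice_for M (rdiv M) ->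
    garside_subgroup M Delta H -> garside_subgroup M Delta K ->
  garside_subgroup M Delta (H `&` K).
Proof.
move=> sM latL latR gH gK.
have [sgH smH _] := gH; have [sgK smK _] := gK.
have sgHK := subgroupI sgH sgK.
split=> //.
  have -> : H `&` K `&` M = (H `&` M) `&` (K `&` M) by rewrite setIACA setIid.
  exact: garside_submonoidI.
apply/seteqP; split; first by apply: smallest_sub => // x [].
move=> x [Hx Kx].
have [ab [[Ha Hb xE _] abM]] :=
  garside_subgroup_decomposition sM latL latR gH Hx.
have [cd [[Kc Kd _ _] cdM]] :=
  garside_subgroup_decomposition sM latL latR gK Kx.
have abcd := fractional_decomposition_unique sM latL latR abM cdM.
rewrite -abcd in Kc Kd; move: Ha Hb Kc Kd => [Ha Ma] [Hb Mb] [Ka _] [Kb _].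
have sgen := subgroup_gen (H `&` K `&` M).
rewrite xE; apply: (subgroupM sgen _ (mem_group_gen _)) => //.
by apply: (subgroupV sgen); apply: mem_group_gen.
Qed.

End Groups.

Theorem proposition2 (G : groupType) (X : set G) (Delta : G)
    (GX : garside_system X)
    (XDelta : garside_element (monoid_gen X) X Delta)
    (finX : finite_set X) :
  let Gp := monoid_gen X in
  [/\ (* (d) *)
      forall H : set G, garside_subgroup Gp Delta H ->
        exists Hp : set G,
          [/\ garside_submonoid Gp Delta Hp,
              garside_monoid Hp
            & group_of_fractions Hp H],
      (* (e) *)
      forall H : set G, garside_subgroup Gp Delta H ->
        forall x : G, H x ->
          exists ab : G * G,
            unique (fractional_decomposition (H `&` Gp) x) ab /\
            unique (fractional_decomposition Gp x) ab
    & (* (f) *)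
      forall H K : set G,
        garside_subgroup Gp Delta H -> garside_subgroup Gp Delta K ->
        garside_subgroup Gp Delta (H `&` K)].
Proof.
move=> Gp; have [sysX _] := GX; have [sM _ [latL latR] _ _] := sysX.
split=> [H gH|H gH x Hx|H K gH gK].
- exists (H `&` Gp); split; first by have [] := gH.
    exact: garside_subgroup_monoid gH.
  exact: garside_subgroup_fractions gH.
- have [latNL latNR] := garside_subgroup_lattices latL latR gH.
  have [_ [[sN _] _ _ _ _] _] := gH.
  have [ab [abN abM]] := garside_subgroup_decomposition sM latL latR gH Hx.
  exists ab; split; split=> // cd; exact: fractional_decomposition_unique.
- exact: garside_subgroupI.
Qed.
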